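(* Let $G$ be a finite soluble group. The following are equivalent: (1) $G$ satisfies the replacement property. (2) $G$ is a $K$-group. (3) $\mu_G(1)\neq 0$.
   Context: Let $G$ be a finite group. A generating set (generating sequence) $\Omega=\{g_1,\dots,g_n\}$ of $G$ is called irredundant (or independent) if every proper subset of $\Omega$ generates a proper subgroup of $G$. Let $m(G)$ be the largest size of an irredundant generating set of $G$. $G$ satisfies the replacement property for the generating sequence $\{g_1,\dots,g_n\}$ if for every $g\in G$ with $g\neq 1$ there exists $i\in\{1,\dots,n\}$ such that $\{g_1,\dots,g_{i-1},g,g_{i+1},\dots,g_n\}$ generates $G$. $G$ satisfies the replacement property if it satisfies the replacement property for all irredundant generating sequences of length $m(G)$. $G$ is a $K$-group (a complemented group) if its subgroup lattice is a complemented lattice, i.e. for every subgroup $H\leq G$ there exists a subgroup $X\leq G$ such that $\langle H,X\rangle=G$ and $H\cap X=1$. The Möbius function $\mu_G$ on the subgroup lattice of $G$ is the integer-valued function defined inductively by $\mu_G(G)=1$ and $\mu_G(H)=-\sum_{H<K\leq G}\mu_G(K)$ for every proper subgroup $H<G$, the sum being over all subgroups $K$ of $G$ properly containing $H$. Here $\mu_G(1)$ is the value at the trivial subgroup. *)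

(* Defs.v *)
From mathcomp Require Import all_boot all_order all_fingroup all_algebra.
From mathcomp Require Import all_solvable.

Set Implicit Arguments.
Unset Strict Implicit.
Unset Printing Implicit Defensive.

Import GroupScope.

Section Definitions.

Variable gT : finGroupType.
Implicit Types (G H K X : {group gT}) (A B : {set gT}) (s : seq gT).

Definition irredundant_gen G A : bool :=
  (<<A>> == G) && [forall B : {set gT}, (B \proper A) ==> (<<B>> \proper G)].

Definition max_irredundant G : nat :=
  \max_(A : {set gT} | irredundant_gen G A) #|A|.

(* An irredundant sequence has no repeated entry, since deleting a repetition *)
(* does not change the subgroup generated; [uniq] makes [size s] the number   *)
(* of elements of the underlying set.                                         *)
Definition irredundant_gen_seq G s : bool :=
  uniq s && irredundant_gen G [set x in s].

Definition replacement_for G s : Prop :=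
  forall g, g \in G -> g != 1 ->
    exists2 i : nat, i < size s & <<[set x in set_nth 1 s i g]>> = G.

Definition replacement_property G : Prop :=
  forall s, irredundant_gen_seq G s -> size s = max_irredundant G ->
    replacement_for G s.

Definition K_group G : Prop :=
  forall H, H \subset G ->
    exists X : {group gT}, [/\ X \subset G, H <*> X = G & H :&: X = 1].

(* The natural number bounds the recursion depth; #|G| steps suffice, so the  *)
(* defining equations [mobius_top] and [mobius_proper] below hold.            *)
Fixpoint mobius_rec G (n : nat) H : int :=
  if n is n'.+1 then
    if H == G then 1%R else
    (- \sum_(K : {group gT} | (H \proper K) && (K \subset G))
        mobius_rec G n' K)%R
  else 0%R.

Definition mobius G H : int := mobius_rec G #|G| H.

Lemma mobius_top G : mobius G G = 1%R.
Proof. by rewrite /mobius -(prednK (cardG_gt0 G)) /= eqxx. Qed.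

Lemma mobius_rec_fuel G n m H : H \subset G ->
  #|G| < n + #|H| -> #|G| < m + #|H| -> mobius_rec G n H = mobius_rec G m H.
Proof.
elim: n m H => [|n IHn] [|m] H sHG ltn ltm //=;
  rewrite ?add0n ?(ltnNge #|G|) ?(subset_leq_card sHG) // in ltn ltm *.
case: ifP => // _; congr (- _)%R; apply: eq_bigr => K /andP[ltHK sKG].
have := proper_card ltHK => ltc.
by apply: IHn => //; rewrite ltnNge -ltnS;
  [move: ltn | move: ltm]; rewrite -!ltnNge addSn => /leq_trans; apply;
  rewrite -addnS leq_add2l.
Qed.

Lemma mobius_proper G H : H \proper G ->
  mobius G H =
    (- \sum_(K : {group gT} | (H \proper K) && (K \subset G)) mobius G K)%R.
Proof.
move=> ltHG; rewrite {1}/mobius -(prednK (cardG_gt0 G)) /=.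
have /negPf-> : H != G by apply: contraTneq ltHG => ->; rewrite properxx.
congr (- _)%R; apply: eq_bigr => K /andP[ltHK sKG].
have gt1K : 1 < #|K| by apply: leq_ltn_trans (proper_card ltHK).
apply: mobius_rec_fuel => //.
  by rewrite -{1}(prednK (cardG_gt0 G)) -addn1 ltn_add2l.
by rewrite -[X in X < _]addn0 ltn_add2l.
Qed.

End Definitions.

(* Main.v *)
Require Import Defs.
From mathcomp Require Import all_boot all_order all_fingroup all_algebra.
From mathcomp Require Import all_solvable.

Import GRing.Theory GroupScope.

Set Implicit Arguments.
Unset Strict Implicit.
Unset Printing Implicit Defensive.

(** Let [N] be a minimal normal subgroup of the soluble group [G]. It is
    abelian, so a subgroup [H] with [N * H = G] either is [G] or complements
    [N] ([supplement_full_or_complement]); hence complements of [N] are maximal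
    subgroups, and they are all isomorphic to [G / N]. From this, each of the
    three properties is seen to obey the same recursion, called
    [complement_recursive] below: [G] has it if and only if [N] has complements
    in [G] and all of them have it. Since the recursion determines a property
    of soluble groups ([complement_recursive_unique]), the three coincide.

    For complemented groups the recursion is a modular law computation.

    For the Moebius function, Weisner's theorem ([sum_mobius_supplements]) says
    that the values [mobius X 1], for [X] a supplement of [N], add up to zero.
    The supplements are [G] and the complements of [N], and the latter all
    contribute the same value, so [mobius G 1] is, up to sign, the number of
    complements times the value for any one of them.

    For the replacement property, write [m] for [max_irredundant]. If [X]
    complements [N], then [m(G) = m(X) + 1] ([max_irredundant_complement]): a
    nontrivial element of [N] extends any irredundant generating set of [X] to
    one of [G]; conversely, from an irredundant generating set of [G] choose a
    part that is minimal generating [G] modulo [N]; it has at most [m(X)]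
    elements and generates [G] or a maximal subgroup, so at most one element
    was left out. In particular an irredundant generating set of [G] of size
    [m(G)] is one of size [m(K)] of some complement [K], with one element
    added, and replacement in [G] reduces to replacement in [K]. Conversely,
    replacement in [X] is replacement in [G] after adding an element of [N];
    and if [N] has no complement, its elements replace nothing. *)

(** * Complements of an abelian minimal normal subgroup *)

Section AbelianMinimalNormal.

Variables (gT : finGroupType) (G N : {group gT}).
Hypotheses (minN : minnormal N G) (sNG : N \subset G) (abN : abelian N).
Implicit Types (H K X Y : {group gT}) (A B : {set gT}).

Lemma minnormal_normal : N <| G.
Proof. by case/mingroupP: minN => /andP[_ nNG] _; apply/andP. Qed.

Lemma minnormal_neq1 : N :!=: 1.
Proof. by case/mingroupP: minN => /andP[]. Qed.

Lemma join_minnormal H : H \subset G -> N <*> H = N * H.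
Proof.
by move=> sHG; rewrite norm_joinEr ?(subset_trans sHG) ?normal_norm
  ?minnormal_normal.
Qed.

(** [N :&: H] is normalised by [H], and by [N] because [N] is abelian, so it
    is normal in [G = N * H]; minimality leaves only [1] and [N]. *)
Lemma supplement_full_or_complement H :
  H \subset G -> N <*> H = G -> H = G \/ H \in [complements to N in G].
Proof.
move=> sHG; rewrite join_minnormal // => defG.
have nNHG: G \subset 'N(N :&: H).
  rewrite -defG mulG_subG; apply/andP; split.
    by rewrite cents_norm // (subset_trans abN) // centS // subsetIl.
  rewrite normsI ?normG // (subset_trans sHG) //.
  exact: normal_norm minnormal_normal.
have [tiNH | ntNH] := eqVneq (N :&: H) 1; first by right; apply/complP.
left; apply: group_inj; rewrite -defG; apply/esym/mulSGid.
case/mingroupP: minN => _ /(_ (N :&: H)%G) /=.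
by rewrite ntNH nNHG subsetIl => /(_ isT isT) <-; apply: subsetIr.
Qed.

Lemma complement_sub X : X \in [complements to N in G] -> X \subset G.
Proof. by case/complP=> _ <-; apply: mulG_subr. Qed.

Lemma complement_join X : X \in [complements to N in G] -> N <*> X = G.
Proof.
by move=> cX; rewrite join_minnormal ?complement_sub //; case/complP: cX.
Qed.

Lemma complement_neq X : X \in [complements to N in G] -> X :!=: G.
Proof.
case/complP=> tiNX _; apply: contraNneq minnormal_neq1 => defX.
by apply/eqP; rewrite -tiNX defX (setIidPl sNG).
Qed.

Lemma card_complement X :
  X \in [complements to N in G] -> (#|N| * #|X|)%N = #|G|.
Proof. by case/complP=> tiNX <-; rewrite TI_cardMg. Qed.

Lemma complement_isog X Y :
    X \in [complements to N in G] -> Y \in [complements to N in G] ->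
  X \isog Y.
Proof.
have nsNG := minnormal_normal.
rewrite -!(complgC N) => /(sdprod_normal_complP nsNG)/sdprod_isog isoX.
move=> /(sdprod_normal_complP nsNG)/sdprod_isog isoY.
by apply: isog_trans isoX _; rewrite isog_sym.
Qed.

(** Anything between a complement [X] and [G] is again a supplement of [N],
    hence is [G] or has the order of [X]: complements are maximal. *)
Lemma complement_maximal X H :
    X \in [complements to N in G] -> X \subset H -> H \subset G ->
  ~~ (H \subset X) -> H :=: G.
Proof.
move=> cX sXH sHG nsHX.
have joinH: N <*> H = G.
  apply/eqP; rewrite eqEsubset join_subG sNG sHG /= -{1}(complement_join cX).
  by rewrite genS // setUS.
have [-> // | cH] := supplement_full_or_complement sHG joinH.
case/negP: nsHX; rewrite (_ : H :=: X) //; apply/esym/eqP.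
rewrite eqEcard sXH -(leq_pmul2l (cardG_gt0 N)).
by rewrite (card_complement cH) (card_complement cX) leqnn.
Qed.

(** The modular law, in the form in which passing to [G / N] becomes passing
    to the complement [X]. *)
Lemma gen_complement X A :
  X \in [complements to N in G] -> A \subset X -> N <*> A = G -> <<A>> = X.
Proof.
move=> cX sAX defG.
have sgAX: <<A>> \subset X by rewrite gen_subG.
have [tiNX defNX] := complP cX.
apply/eqP; rewrite eqEcard sgAX -(leq_pmul2l (cardG_gt0 N)).
rewrite (card_complement cX) -defG -(joing_idr N A) join_minnormal.
  by rewrite mul_cardG leq_pmulr ?cardG_gt0.
by rewrite (subset_trans sgAX) ?complement_sub.
Qed.

End AbelianMinimalNormal.

(** * Recursion along complements *)

(** The group [X] plays the part of the quotient [G / N]; keeping it inside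
    [G] lets an induction stay among the subgroups of one group. *)
Definition complement_recursive (gT : finGroupType)
    (P : {group gT} -> Prop) : Prop :=
  P 1%G /\
  forall G N : {group gT}, minnormal N G -> N \subset G -> abelian N ->
    (P G <-> (exists X, X \in [complements to N in G]) /\
             (forall X, X \in [complements to N in G] -> P X)).

(** A complement-recursive property is determined on soluble groups by the
    recursion alone, since minimal normal subgroups are then abelian. *)
Lemma complement_recursive_unique (gT : finGroupType)
    (P Q : {group gT} -> Prop) :
    complement_recursive P -> complement_recursive Q ->
  forall G : {group gT}, solvable G -> P G <-> Q G.
Proof.
move=> [P1 recP] [Q1 recQ] G; have [n] := ubnP #|G|.
elim: n G => // n IHn G leGn solG.
have [G1 | ntG] := eqVneq (G : {set gT}) 1.
  by have -> : G = 1%G by apply: group_inj.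
have [N minN sNG] := minnormal_exists ntG (normG G).
have [_ _ /is_abelemP[p _ /abelem_abelian abN]] :=
  minnormal_solvable minN sNG solG.
have IHX X : X \in [complements to N in G] -> P X <-> Q X.
  move=> cX; have sXG := complement_sub cX.
  apply: IHn; last exact: solvableS solG.
  apply: leq_trans (proper_card _) leGn.
  by rewrite properEneq sXG (complement_neq minN sNG).
apply: (iff_trans (recP _ _ minN sNG abN)).
apply: iff_trans (iff_sym (recQ _ _ minN sNG abN)).
by split=> -[exC propC]; split=> // X cX; apply/(IHX X cX)/propC.
Qed.

(** * Complemented groups *)

Section ComplementedGroups.

Variables (gT : finGroupType) (G N : {group gT}).
Hypotheses (minN : minnormal N G) (sNG : N \subset G) (abN : abelian N).
Implicit Types (H X Y : {group gT}).

(** For [H <= X], a complement [Y] of the larger group [N <*> H] in [G] is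
    pushed into [X] as [X :&: (N <*> Y)]; this is the correspondence between
    [X] and [G / N], under which [H] and [N <*> H] are the same subgroup. *)
Lemma K_group_complement X :
  X \in [complements to N in G] -> K_group G -> K_group X.
Proof.
move=> cX KG H sHX; have sXG := complement_sub cX.
have [tiNX defNX] := complP cX.
have sHG := subset_trans sHX sXG.
have sNHG: (N <*> H)%G \subset G by rewrite join_subG sNG.
have [Y [sYG genY tiY]] := KG _ sNHG.
have sNYG: N <*> Y \subset G by rewrite join_subG sNG.
have defNY: N <*> (X :&: (N <*> Y)) = N <*> Y.
  rewrite (@join_minnormal _ _ _ minN sNG (X :&: (N <*> Y))%G) /=;
    last by rewrite subIset ?sXG.
  by rewrite group_modl ?joing_subl // defNX (setIidPr sNYG).
exists (X :&: (N <*> Y))%G; split; first exact: subsetIl.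
  apply: (gen_complement minN sNG cX); first by rewrite subUset sHX subsetIl.
  rewrite -joing_idr -/(joing H _) (joingC H) joingA defNY.
  by rewrite -joingA (joingC Y) joingA.
apply/trivgP.
have sHN: H :&: (N <*> Y) \subset N.
  rewrite [N <*> Y](join_minnormal minN) //.
  have sNH : H \subset N <*> H by apply: joing_subr.
  apply: subset_trans (setSI _ sNH) _.
  by rewrite setIC -group_modl ?joing_subl // setIC tiY mulg1.
by rewrite -tiNX /= setIA (setIidPl sHX) subsetI sHN subIset ?sHX.
Qed.

(** Take [Y] complementing the trace of [N <*> H] on [X]. As [H <*> Y] is a
    supplement of [N], either it is [G] and [Y] complements [H], or it avoids
    [N], so that [H] does too and [Y] can be enlarged to [N <*> Y]. *)
Lemma K_group_of_complement X :
  X \in [complements to N in G] -> K_group X -> K_group G.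
Proof.
move=> cX KX H sHG; have sXG := complement_sub cX.
have [_ defNX] := complP cX.
have sNHG: N <*> H \subset G by rewrite join_subG sNG.
have [Y [sYX genY tiY]] := KX (X :&: (N <*> H))%G (subsetIl _ _).
have sYG := subset_trans sYX sXG.
have defNXH: N <*> (X :&: (N <*> H)) = N <*> H.
  rewrite (@join_minnormal _ _ _ minN sNG (X :&: (N <*> H))%G) /=;
    last by rewrite subIset ?sXG.
  by rewrite group_modl ?joing_subl // defNX (setIidPr sNHG).
have genNHY: N <*> (H <*> Y) = G.
  by rewrite joingA -defNXH -joingA genY (complement_join minN sNG cX).
have tiHY: H :&: Y = 1.
  apply/trivgP; rewrite -tiY subsetI subsetIr andbT.
  by rewrite subsetI subIset ?sYX ?orbT //= subIset // joing_subr.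
have sHYG: (H <*> Y)%G \subset G by rewrite join_subG sHG.
have [defG | cHY] := supplement_full_or_complement minN sNG abN sHYG genNHY.
  by exists Y; split=> //; apply: congr_group defG.
exists (N <*> Y)%G; split; first by rewrite join_subG sNG.
  by rewrite /= joingA (joingC H) -joingA.
have tiNH: N :&: H = 1.
  apply/trivgP; case/complP: cHY => <- _.
  by rewrite setIS // joing_subl.
apply/trivgP; rewrite -tiNH subsetI subsetIl andbT.
rewrite /= [N <*> Y](join_minnormal minN) //.
have sHNH : H \subset N <*> H by apply: joing_subr.
apply: subset_trans (setSI _ sHNH) _.
rewrite setIC -group_modl ?joing_subl // -(setIidPl sYX) -setIA (setIC Y) tiY.
by rewrite mulg1.
Qed.

End ComplementedGroups.

Lemma K_group_recursive (gT : finGroupType) :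
  complement_recursive (@K_group gT).
Proof.
split=> [H /trivgP H1 | G N minN sNG abN].
  by exists 1%G; split; rewrite //= H1 ?setI1g // /joing setUid genGid.
split=> [KG | [[X cX] KX]]; last first.
  exact: (K_group_of_complement minN sNG abN cX) (KX X cX).
have [X [sXG genX tiX]] := KG N sNG.
have cX : X \in [complements to N in G].
  by apply/complP; rewrite -(join_minnormal minN sNG).
by split=> [|Y cY]; [exists X | apply: K_group_complement cY KG].
Qed.

(** * The Moebius function of a soluble group *)

Section Moebius.

Variable gT : finGroupType.
Implicit Types (G H K N X Y Z : {group gT}).

Lemma sum_mobius_above G H : H \subset G ->
  (\sum_(K : {group gT} | (H \subset K) && (K \subset G)) mobius G K
    = (H == G)%:R :> int)%R.
Proof.
move=> sHG; have [-> | neHG] := eqVneq H G.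
  rewrite (big_pred1 G) ?mobius_top // => K.
  by rewrite -eqEsubset eq_sym.
rewrite (bigD1 H) ?subxx //= mobius_proper; last by rewrite properEneq neHG.
rewrite addrC; apply/eqP; rewrite subr_eq0; apply/eqP.
by apply: eq_bigl => K; rewrite properEneq eq_sym andbC andbA.
Qed.

(** The defining recursion of the Moebius function runs over the bottom of an
    interval, this one over its top: a left inverse of the incidence matrix of
    inclusion is also a right inverse. Concretely, sum
    [mobius Z K * mobius X 1] over all [X <= K <= Z]: summing over [K] first
    leaves [mobius Z 1], summing over [X] first and using induction leaves the
    terms [K = Z] and [K = 1]. *)
Lemma sum_mobius_below Z :
  (\sum_(X : {group gT} | X \subset Z) mobius X 1%G = (Z == 1%G)%:R :> int)%R.
Proof.
have [n] := ubnP #|Z|; elim: n Z => // n IHn Z leZn.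
pose S K := (\sum_(X : {group gT} | X \subset K) mobius X 1%G)%R.
have dsum : (\sum_(K : {group gT} | K \subset Z) mobius Z K * S K
    = mobius Z 1%G :> int)%R.
  under eq_bigr => K _ do rewrite mulr_sumr.
  rewrite (exchange_big_dep (fun X => X \subset Z)) /=; last first.
    by move=> K X sKZ sXK; apply: subset_trans sXK sKZ.
  (* By [sum_mobius_above] only [X = Z] contributes. *)
  rewrite (bigD1 Z) //= [X in (_ + X)%R]big1 ?addr0.
    rewrite (big_pred1 Z) => [|K]; last by rewrite -eqEsubset.
    by rewrite mobius_top mul1r.
  move=> X /andP[sXZ neXZ]; rewrite -mulr_suml.
  under eq_bigl => K do rewrite andbC.
  by rewrite sum_mobius_above // (negPf neXZ) mul0r.
rewrite -/(S Z).
have SK K : K \proper Z -> S K = ((K == 1%G)%:R)%R.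
  by move=> /proper_card ltKZ; apply: IHn; apply: leq_trans ltKZ leZn.
move: dsum; rewrite (bigD1 Z) //= mobius_top mul1r => dsum.
have [Z1 | ntZ] := eqVneq Z 1%G.
  move: dsum; rewrite Z1 mobius_top big1 ?addr0 // => K /andP[/trivgP K1].
  by case/eqP; apply: group_inj.
move/eqP: dsum; rewrite (bigD1 1%G) /= ?sub1G 1?eq_sym ?ntZ //.
rewrite (SK 1%G) ?eqxx ?mulr1; last by rewrite proper1G; exact: ntZ.
rewrite big1 ?addr0 => [|K /andP[/andP[sKZ neKZ] ntK]]; last first.
  by rewrite SK ?(negPf ntK) ?mulr0 // properEneq neKZ.
by rewrite -subr_eq subrr => /eqP <-.
Qed.

(** Weisner's theorem: grouping the subgroups [X] of [Z] according to
    [N <*> X] turns the vanishing of [sum_mobius_below] into the vanishing of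
    the part of each group, by induction on [Z]. *)
Lemma sum_mobius_supplements N Z : N :!=: 1 -> N \subset Z ->
  (\sum_(X : {group gT} | (N <*> X)%G == Z) mobius X 1%G = 0 :> int)%R.
Proof.
move=> ntN; have [n] := ubnP #|Z|; elim: n Z => // n IHn Z leZn sNZ.
have ntZ : Z != 1%G.
  apply: contraNneq ntN => Z1; apply/eqP/trivgP; rewrite (subset_trans sNZ) //.
  by rewrite Z1.
have := sum_mobius_below Z; rewrite (negPf ntZ).
rewrite (partition_big (fun X => (N <*> X)%G)
          (fun Y => (N \subset Y) && (Y \subset Z))) /=; last first.
  by move=> X sXZ; rewrite joing_subl join_subG sNZ.
rewrite (bigD1 Z) ?sNZ ?subxx //= [X in (_ + X)%R]big1 ?addr0 => [sumZ|].
  apply: etrans sumZ; apply: eq_bigl => X; apply/esym; rewrite andbC.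
  apply: andb_idr => /eqP <-.
  exact: joing_subr.
move=> Y /andP[/andP[sNY sYZ] neYZ].
rewrite -[RHS](IHn Y _ sNY); last first.
  by apply: leq_trans (proper_card _) leZn; rewrite properEneq neYZ.
apply: eq_bigl => X; rewrite andbC; apply: andb_idr => /eqP defY.
by apply: subset_trans sYZ; rewrite -defY joing_subr.
Qed.

End Moebius.

Lemma mobius_rec_injm (aT rT : finGroupType) (D : {group aT})
    (f : {morphism D >-> rT}) (injf : 'injm f) n (G H : {group aT}) :
    G \subset D -> H \subset G ->
  mobius_rec (f @* G)%G n (f @* H)%G = mobius_rec G n H.
Proof.
elim: n H => // n IHn H sGD sHG /=; have sHD := subset_trans sHG sGD.
have -> : ((f @* H)%G == (f @* G)%G) = (H == G).
  apply/eqP/eqP => [eq_f | -> //]; apply/group_inj.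
  by apply: (injm_morphim_inj injf) => //; apply: congr_group eq_f.
case: ifP => // _; congr (- _)%R.
rewrite (reindex_onto (fun K => f @* K)%G (fun L => f @*^-1 L)%G) /=;
  last first.
  move=> L /andP[_ sLG]; apply: group_inj; apply: morphpreK.
  by apply: subset_trans sLG _; apply: morphimS.
apply: eq_big => K.
  have [sKD | nsKD] := boolP (K \subset D).
    rewrite !properE !injmSK //.
    suff -> : ((f @*^-1 (f @* K))%G == K) by rewrite andbT.
    by apply/eqP/group_inj; apply: injmK.
  have /negPf-> : ~~ ((H \proper K) && (K \subset G)).
    by apply: contra nsKD => /andP[_ sKG]; apply: subset_trans sKG sGD.
  apply/negbTE; rewrite !negb_and; apply/orP; right.
  by apply: contraNneq nsKD => <-; apply: subsetIl.
case/andP=> /andP[_ sKG] /eqP defK; apply: IHn => //.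
rewrite -(injmSK injf) // -defK; exact: subsetIl.
Qed.

Lemma mobius1_isog (aT rT : finGroupType) (X : {group aT}) (Y : {group rT}) :
  X \isog Y -> mobius X 1%G = mobius Y 1%G.
Proof.
case/isogP=> f injf defY; have -> : Y = (f @* X)%G by apply: group_inj.
rewrite /mobius card_injm // -(mobius_rec_injm injf) ?sub1G //.
by congr mobius_rec; apply: group_inj; rewrite /= morphim1.
Qed.

(** In [sum_mobius_supplements] only [G] itself and the complements of [N]
    contribute. *)
Lemma mobius1_sum_complements (gT : finGroupType) (G N : {group gT}) :
    minnormal N G -> N \subset G -> abelian N ->
  (mobius G 1%G
    = - \sum_(X in [complements to N in G]) mobius X 1%G)%R.
Proof.
move=> minN sNG abN; have ntN := minnormal_neq1 minN.
have := sum_mobius_supplements ntN sNG.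
rewrite (bigD1 G) /=; last by apply/eqP/group_inj/joing_idPr.
move/eqP; rewrite addr_eq0 => /eqP ->; congr (- _)%R.
have defC (Y : {group gT}) :
    ((N <*> Y)%G == G) && (Y != G) = (Y \in [complements to N in G]).
  apply/andP/idP => [[/eqP defG neYG] | cY].
    have sYG : Y \subset G by rewrite -defG joing_subr.
    have := supplement_full_or_complement minN sNG abN sYG.
    by case=> [|defY|//]; [apply: congr_group | rewrite defY eqxx in neYG].
  split; first by apply/eqP/group_inj/(complement_join minN sNG cY).
  by apply: contraNneq (complement_neq minN sNG cY) => ->.
exact: eq_bigl.
Qed.

(** All complements of [N] are isomorphic, so the sum over them is a positive
    multiple of each of its terms, unless it is empty. *)
Lemma mobius1_recursive (gT : finGroupType) :
  complement_recursive (fun G : {group gT} => mobius G 1%G <> 0%R).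
Proof.
split=> [|G N minN sNG abN]; first by rewrite mobius_top.
rewrite (mobius1_sum_complements minN sNG abN).
have [-> | [X cX]] := set_0Vmem [complements to N in G].
  by rewrite big_set0 oppr0; split=> [//|[[X]]]; rewrite inE.
have eq_mu (Y : {group gT}) :
    Y \in [complements to N in G] -> mobius Y 1%G = mobius X 1%G.
  by move=> cY; apply/mobius1_isog/(complement_isog minN sNG cY cX).
rewrite (eq_bigr (fun=> mobius X 1%G)) // sumr_const.
split=> [muG | [_ muX] /eqP].
  split=> [|Y cY]; first by exists X.
  by rewrite eq_mu // => muX; apply: muG; rewrite muX mul0rn oppr0.
rewrite oppr_eq0 Num.Theory.mulrn_eq0 => /orP[|/eqP]; last exact: muX.
by rewrite -leqn0 leqNgt; case/negP; apply/card_gt0P; exists X.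
Qed.

(** * Irredundant generating sets *)

Section Irredundance.

Variable gT : finGroupType.
Implicit Types (G H N X : {group gT}) (A B C : {set gT}).

(** It is enough to delete one element at a time. *)
Lemma irredundant_genP G A :
  reflect (<<A>> = G /\ forall a, a \in A -> <<A :\ a>> != G)
          (irredundant_gen G A).
Proof.
apply: (iffP andP) => [[/eqP defG /forallP irrA] | [defG irrA]].
  split=> // a Aa; have /implyP/(_ (properD1 Aa)) := irrA (A :\ a).
  by rewrite properEneq => /andP[].
rewrite defG; split=> //; apply/forallP=> B; apply/implyP=> /properP[sBA].
case=> a Aa nBa; have sBAa : <<B>> \subset <<A :\ a>>.
  by rewrite genS // subsetD1 sBA.
have sAaG : <<A :\ a>> \subset G by rewrite -defG genS ?subD1set.
by apply: sub_proper_trans sBAa _; rewrite properEneq irrA.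
Qed.

Lemma irredundant_gen_eq G A B :
  irredundant_gen G A -> B \subset A -> <<B>> = G -> B = A.
Proof.
move=> /andP[_ /forallP/(_ B)/implyP irrA]; rewrite subEproper.
by case/predU1P=> // /irrA/proper_neq/eqP.
Qed.

Lemma irredundant_gen_sub A :
  exists2 B : {set gT}, B \subset A & irredundant_gen <<A>>%G B.
Proof.
have [B minB sBA] := @minset_exists _ (fun B => <<B>> == <<A>>) A (eqxx _).
exists B => //; have /minsetP[/eqP genB minimalB] := minB.
apply/irredundant_genP; split=> // b Bb; apply/eqP=> genBb.
have := minimalB _ (introT eqP genBb) (subD1set _ _).
by move/setP/(_ b); rewrite Bb !inE eqxx.
Qed.

Lemma leq_max_irredundant G A :
  irredundant_gen G A -> #|A| <= max_irredundant G.
Proof. exact: leq_bigmax_cond. Qed.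

Lemma max_irredundant_attained G :
  exists2 A, irredundant_gen G A & #|A| = max_irredundant G.
Proof.
have [A _] := irredundant_gen_sub G.
rewrite (_ : <<G>>%G = G) => [irrA|]; last by apply: group_inj; apply: genGid.
have : 0 < #|[pred A | irredundant_gen G A]| by apply/card_gt0P; exists A.
by case/(eq_bigmax_cond (fun A => #|A|)) => B irrB eqB; exists B.
Qed.

(** The replacement property speaks only of the underlying sets of the
    sequences involved. *)
Lemma replacement_propertyP G :
  replacement_property G <->
  (forall A, irredundant_gen G A -> #|A| = max_irredundant G ->
   forall g, g \in G -> g != 1 -> exists2 a, a \in A & <<g |: A :\ a>> = G).
Proof.
have set_of_set_nth (s : seq gT) i g : uniq s -> i < size s ->
    [set x in set_nth 1 s i g] = g |: [set x in s] :\ nth 1 s i.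
  move=> Us lti; apply/setP=> x; rewrite !inE set_nthE lti mem_cat inE.
  have defs : take i s ++ nth 1 s i :: drop i.+1 s = s.
    by rewrite -drop_nth // cat_take_drop.
  have -> : (x \in s) =
      [|| x \in take i s, x == nth 1 s i | x \in drop i.+1 s].
    by rewrite -{1}defs mem_cat inE.
  move: Us; rewrite -{1}defs cat_uniq /= negb_or -!andbA.
  case/and5P=> _ notT _ notD _; have [-> | _] := eqVneq x (nth 1 s i).
    by rewrite (negPf notT) (negPf notD) orbF.
  by rewrite orbCA.
split=> [replG A irrA cardA g Gg ntg | replG s /andP[Us irrs] szs g Gg ntg].
  have defA : [set x in enum A] = A by apply/setP=> x; rewrite inE mem_enum.
  have [||i lti defG] := replG (enum A) _ _ g Gg ntg.
  - by rewrite /irredundant_gen_seq enum_uniq defA.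
  - by rewrite -cardE.
  exists (nth 1 (enum A) i); first by rewrite -mem_enum mem_nth.
  by rewrite set_of_set_nth ?enum_uniq // defA in defG.
have cards : #|[set x in s]| = max_irredundant G.
  by rewrite cardsE -szs; apply/card_uniqP.
have [a] := replG _ irrs cards g Gg ntg; rewrite inE => sa defG.
exists (index a s); first by rewrite index_mem.
by rewrite set_of_set_nth ?index_mem // nth_index.
Qed.

End Irredundance.

(** * Irredundant generation across a complement *)

Section IrredundanceAcrossComplement.

Variables (gT : finGroupType) (G N : {group gT}).
Hypotheses (minN : minnormal N G) (sNG : N \subset G) (abN : abelian N).
Implicit Types (X : {group gT}) (A B : {set gT}).

(** The projection onto [X] along [N] does not change elements modulo [N].
    So the image of [B] generates [X], and as [B] is minimal, the projection is
    injective on [B] and the image is irredundant. *)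
Lemma card_minimal_mod X B :
    X \in [complements to N in G] ->
    minset (fun C : {set gT} => N <*> C == G) B ->
  #|B| <= max_irredundant X.
Proof.
move=> cX /minsetP[/eqP genB minB]; have [_ defNX] := complP cX.
have sBG : B \subset G by rewrite -genB sub_gen // subsetUr.
pose p := remgr N X.
have mem_p g : g \in G -> p g \in X by rewrite -defNX => /mem_remgr.
have mod_p (C : {set gT}) : C \subset G -> N <*> (p @: C) = N <*> C.
  move=> /subsetP sCG; apply/eqP; rewrite eqEsubset !join_subG !joing_subl /=.
  apply/andP; split; apply/subsetP.
    move=> _ /imsetP[c Cc ->].
    rewrite -(mulKg (divgr N X c) (p c)) -divgr_eq groupM ?groupV //.
      by rewrite (subsetP (joing_subl _ _)) // mem_divgr // defNX sCG.
    by rewrite (subsetP (joing_subr _ _)).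
  move=> c Cc; rewrite (divgr_eq N X c) groupM //.
    by rewrite (subsetP (joing_subl _ _)) // mem_divgr // defNX sCG.
  by rewrite (subsetP (joing_subr _ _)) // imset_f.
have minp (C : {set gT}) : C \subset B -> <<p @: C>> = X -> C = B.
  move=> sCB genC; apply: minB => //; rewrite -mod_p ?(subset_trans sCB) //.
  by rewrite -joing_idr genC (complement_join minN sNG cX).
have spX (C : {set gT}) : C \subset B -> p @: C \subset X.
  move=> sCB; apply/subsetP=> _ /imsetP[c Cc ->]; apply: mem_p.
  by rewrite (subsetP sBG) ?(subsetP sCB).
have genp : <<p @: B>> = X.
  by apply: (gen_complement minN sNG cX); rewrite ?spX ?mod_p.
have notD1 b : b \in B -> <<p @: (B :\ b)>> <> X.
  move=> Bb /(minp _ (subD1set _ _))/setP/(_ b).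
  by rewrite Bb !inE eqxx.
have injp : {in B &, injective p}.
  move=> b c Bb Bc eq_p; apply/eqP/negP=> /negP neq_bc; apply: (notD1 b Bb).
  rewrite -genp; congr <<_>>; apply/eqP; rewrite eqEsubset imsetS ?subD1set //=.
  apply/subsetP=> _ /imsetP[d Bd ->]; have [-> | neq_db] := eqVneq d b.
    by rewrite eq_p imset_f // !inE eq_sym neq_bc.
  by rewrite imset_f // !inE neq_db.
rewrite -(card_in_imset injp); apply: leq_max_irredundant.
apply/irredundant_genP; split=> // _ /imsetP[b Bb ->]; apply/eqP=> genD1.
apply: (notD1 b Bb); apply/eqP; rewrite eqEsubset gen_subG spX ?subD1set //=.
rewrite -genD1 genS //; apply/subsetP=> x /setD1P[nepb /imsetP[c Bc defc]].
rewrite defc imset_f // !inE Bc andbT.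
by apply: contraNneq nepb => <-; rewrite defc.
Qed.

(** A part of [A] that is minimal generating [G] modulo [N] generates a
    supplement of [N]: if this is [G], the part is all of [A]; if this is a
    complement, then it is maximal and one more element suffices. *)
Lemma irredundant_gen_split X A :
    X \in [complements to N in G] -> irredundant_gen G A ->
  #|A| <= max_irredundant X \/
  exists a, [/\ a \in A, <<A :\ a>>%G \in [complements to N in G]
             & #|A| <= (max_irredundant X).+1].
Proof.
move=> cX irrA; have [genA _] := irredundant_genP _ _ irrA.
have sAG : A \subset G by rewrite -genA sub_gen.
have genNA : N <*> A == G.
  by rewrite -joing_idr genA; apply/eqP/joing_idPr.
have [B minB sBA] :=
  @minset_exists _ (fun C : {set gT} => N <*> C == G) A genNA.
have leB := card_minimal_mod cX minB.
have sgBG : <<B>>%G \subset G by rewrite gen_subG (subset_trans sBA).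
have genNB : N <*> <<B>>%G = G by rewrite joing_idr; apply/eqP/(minsetp minB).
have [defG | cB] := supplement_full_or_complement minN sNG abN sgBG genNB.
  by left; rewrite -(irredundant_gen_eq irrA sBA (congr_group defG)).
right; have nsAB : ~~ (A \subset <<B>>).
  apply: contra (complement_neq minN sNG cB) => sAB.
  by rewrite eqEsubset sgBG -genA gen_subG.
have [a Aa nBa] := subsetPn nsAB.
have defA : a |: B = A.
  apply: (irredundant_gen_eq irrA); first by rewrite subUset sub1set Aa.
  apply: (complement_maximal minN sNG abN cB (H := <<a |: B>>%G)).
  - by rewrite genS ?subsetUr.
  - by rewrite gen_subG subUset sub1set (subsetP sAG) // (subset_trans sBA).
  by apply: contra nBa => /subsetP; apply; rewrite mem_gen // setU11.
have nBa' : a \notin B by apply: contra nBa; apply: mem_gen.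
exists a; rewrite -defA setU1K // cardsU1 nBa' ltnS.
by split=> //; apply: setU11.
Qed.

(** A nontrivial element of [N] extends any generating set of the maximal
    subgroup [X] to one of [G], and cannot replace an element of it modulo
    [N]. *)
Lemma irredundant_gen_extend X A n :
    X \in [complements to N in G] -> irredundant_gen X A ->
    n \in N -> n != 1 ->
  irredundant_gen G (n |: A).
Proof.
move=> cX /irredundant_genP[genA irrA] Nn ntn; have [tiNX _] := complP cX.
have nXn : n \notin X.
  by apply: contra ntn => Xn; rewrite -in_set1 -[[set 1]]tiNX inE Nn.
have sAX : A \subset X by rewrite -genA sub_gen.
have sXG := complement_sub cX.
have nAn : n \notin A by apply: contra nXn; apply: (subsetP sAX).
apply/irredundant_genP; split=> [|a].
  apply: (complement_maximal minN sNG abN cX (H := <<n |: A>>%G)).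
  - by rewrite -genA genS ?subsetUr.
  - by rewrite gen_subG subUset sub1set (subsetP sNG) // (subset_trans sAX).
  by apply: contra nXn => /subsetP; apply; rewrite mem_gen // setU11.
case/setU1P=> [-> | Aa].
  by rewrite setU1K // genA (complement_neq minN sNG cX).
apply: contra (irrA a Aa) => /eqP genD; apply/eqP.
apply: (gen_complement minN sNG cX).
  by rewrite (subset_trans _ sAX) ?subD1set.
apply/eqP; rewrite eqEsubset join_subG sNG.
rewrite (subset_trans _ (subset_trans sAX sXG)) ?subD1set //=.
rewrite -genD gen_subG; apply/subsetP=> x /setD1P[neqxa /setU1P[-> | Ax]].
  by rewrite (subsetP (joing_subl _ _)).
by rewrite (subsetP (joing_subr _ _)) // !inE neqxa.
Qed.

Lemma max_irredundant_complement X :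
  X \in [complements to N in G] -> max_irredundant G = (max_irredundant X).+1.
Proof.
move=> cX; apply/eqP; rewrite eqn_leq; apply/andP; split.
  have [A irrA <-] := max_irredundant_attained G.
  by have [/leqW // | [a []]] := irredundant_gen_split cX irrA.
have [A irrA <-] := max_irredundant_attained X.
have [n Nn ntn] := trivgPn _ (minnormal_neq1 minN).
have := leq_max_irredundant (irredundant_gen_extend cX irrA Nn ntn).
rewrite cardsU1 (_ : n \notin A) //; apply: contra ntn => An.
have [tiNX _] := complP cX; have [genA _] := irredundant_genP _ _ irrA.
by rewrite -in_set1 -[[set 1]]tiNX inE Nn -genA mem_gen.
Qed.

(** * The replacement property *)

(** If [N] had no complement, an element of [N] would replace nothing: the
    remaining generators would generate [G] modulo [N], hence [G] itself. *)
Lemma replacement_complement_exists :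
  replacement_property G -> exists X, X \in [complements to N in G].
Proof.
move=> /replacement_propertyP replG.
have [A irrA cardA] := max_irredundant_attained G.
have [n Nn ntn] := trivgPn _ (minnormal_neq1 minN).
have [a Aa genG] := replG A irrA cardA n (subsetP sNG n Nn) ntn.
have [genA neqA] := irredundant_genP _ _ irrA.
have sDG : <<A :\ a>>%G \subset G by rewrite -genA genS ?subD1set.
have genND : N <*> <<A :\ a>>%G = G.
  apply/eqP; rewrite eqEsubset join_subG sNG sDG /= joing_idr -genG gen_subG.
  by rewrite sub_gen // setSU // sub1set.
have [defG | cD] := supplement_full_or_complement minN sNG abN sDG genND.
  by case/eqP: (neqA a Aa); apply: congr_group defG.
by exists <<A :\ a>>%G.
Qed.

(** Extend an irredundant generating set of [X] by some [n] in [N] and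
    replace in [G]: the replaced element is not [n], since the result does
    not lie in [X]; then go back to [X] modulo [N]. *)
Lemma replacement_to_complement X :
    X \in [complements to N in G] ->
  replacement_property G -> replacement_property X.
Proof.
move=> cX /replacement_propertyP replG; apply/replacement_propertyP.
move=> A irrA cardA g Xg ntg; have [genA _] := irredundant_genP _ _ irrA.
have sAX : A \subset X by rewrite -genA sub_gen.
have sXG := complement_sub cX; have [tiNX _] := complP cX.
have [n Nn ntn] := trivgPn _ (minnormal_neq1 minN).
have nAn : n \notin A.
  apply: contra ntn => An.
  by rewrite -in_set1 -[[set 1]]tiNX inE Nn (subsetP sAX).
have [||a] := replG _ (irredundant_gen_extend cX irrA Nn ntn) _ g _ ntg.
- by rewrite cardsU1 nAn cardA (max_irredundant_complement cX).
- exact: subsetP sXG g Xg.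
case/setU1P=> [-> | Aa] genG.
  have /negP[] := complement_neq minN sNG cX.
  rewrite eqEsubset sXG -genG gen_subG setU1K // subUset sub1set Xg.
  exact: sAX.
exists a => //; apply: (gen_complement minN sNG cX).
  by rewrite subUset sub1set Xg (subset_trans _ sAX) ?subD1set.
apply/eqP; rewrite eqEsubset join_subG sNG /= subUset sub1set.
rewrite (subsetP sXG) // (subset_trans _ (subset_trans sAX sXG)) ?subD1set //=.
rewrite -genG gen_subG; apply/subsetP=> x.
case/setU1P=> [-> | /setD1P[neqxa /setU1P[-> | Ax]]].
- by rewrite mem_gen // !inE eqxx orbT.
- by rewrite mem_gen // !inE Nn.
by rewrite mem_gen // !inE neqxa Ax !orbT.
Qed.

(** An irredundant generating set [A] of [G] of maximal size consists of one
    element [a] and of a generating set of maximal size of a complement [K] of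
    [N]. An element outside the maximal subgroup [K] replaces [a]; within [K]
    the replacement property of [K] applies, and [a] can be put back. *)
Lemma replacement_of_complements :
    (exists X, X \in [complements to N in G]) ->
    (forall X, X \in [complements to N in G] -> replacement_property X) ->
  replacement_property G.
Proof.
case=> X cX replX; apply/replacement_propertyP=> A irrA cardA g Gg ntg.
have [|[a [Aa cK _]]] := irredundant_gen_split cX irrA.
  by rewrite cardA (max_irredundant_complement cX) ltnn.
set K := <<A :\ a>>%G in cK.
have [genA neqA] := irredundant_genP _ _ irrA.
have [Kg | nKg] := boolP (g \in K); last first.
  exists a => //.
  apply: (complement_maximal minN sNG abN cK (H := <<g |: A :\ a>>%G)).
  - by rewrite genS ?subsetUr.
  - rewrite gen_subG subUset sub1set Gg.
    by rewrite -genA sub_gen ?subD1set.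
  by apply: contra nKg => /subsetP; apply; rewrite mem_gen // setU11.
have irrD : irredundant_gen K (A :\ a).
  apply/irredundant_genP; split=> // b /setD1P[neqba Ab].
  apply: contra (neqA b Ab) => /eqP genD; rewrite eqEsubset.
  rewrite -genA genS ?subD1set //= gen_subG; apply/subsetP=> x Ax.
  have [-> | neqxa] := eqVneq x a.
    by rewrite mem_gen // !inE eq_sym neqba.
  have : x \in K by rewrite mem_gen // !inE neqxa.
  rewrite -genD; apply/subsetP/genS; apply/setSD/subD1set.
have cardD : #|A :\ a| = max_irredundant K.
  by move: cardA; rewrite (max_irredundant_complement cK) (cardsD1 a) Aa => -[].
have /replacement_propertyP replK := replX K cK.
have [b /setD1P[neqba Ab] genK] := replK _ irrD cardD g Kg ntg.
exists b => //; apply/eqP; rewrite eqEsubset gen_subG subUset sub1set Gg /=.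
rewrite -genA sub_gen ?subD1set //= gen_subG; apply/subsetP=> x Ax.
have [-> | neqxa] := eqVneq x a; last first.
  have : x \in K by rewrite mem_gen // !inE neqxa.
  by rewrite -genK; apply/subsetP/genS; apply/setUS/setSD/subD1set.
by rewrite mem_gen // !inE [a == b]eq_sym neqba Aa orbT.
Qed.

End IrredundanceAcrossComplement.

Lemma replacement_property_recursive (gT : finGroupType) :
  complement_recursive (@replacement_property gT).
Proof.
split=> [s _ _ g /set1P-> /eqP // | G N minN sNG abN].
split=> [replG | [exC replC]]; last exact: replacement_of_complements exC replC.
split=> [|X cX]; first exact: replacement_complement_exists replG.
exact: replacement_to_complement cX replG.
Qed.

Theorem theorem1 (gT : finGroupType) (G : {group gT}) (solG : solvable G) :
  (replacement_property G <-> K_group G) /\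
  (K_group G <-> mobius G 1%G <> 0%R).
Proof.
have recK := @K_group_recursive gT.
split; first exact: (complement_recursive_unique
                       (@replacement_property_recursive gT) recK).
exact: (complement_recursive_unique recK (@mobius1_recursive gT)).
Qed.
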